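(* Let $n\in\mathbb N_0$, $q\in\mathbb C\setminus\{0\}$ with $|q|\neq1$, $z\in\mathbb C\setminus\{0\}$, and fix a square root $q^{1/2}$ of $q$. Then $$z^n\,{}_2\phi_0\left(q^{-2n},0;\ -;\ q^2,\frac{q^{2n}}{z^2}\right)=q^{-\frac n2}(-q;q)_n\;{}_3\phi_2\left(q^{-n},\,q^{\frac12}z,\,q^{\frac12}z^{-1};\ -q,\,0;\ q,q\right),$$ and, provided $(q^{\frac12}z,q^{\frac12}z^{-1};q)_n\neq0$, both sides are also equal to $$(-1)^nq^{-\frac{n^2}2}(q^{\frac12}z,q^{\frac12}z^{-1};q)_n\;{}_2\phi_2\left(q^{-n},\,-q^{-n};\ q^{\frac12-n}z,\,q^{\frac12-n}z^{-1};\ q,-q\right).$$ These expressions are invariant under the replacement $z\mapsto z^{-1}$.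
   Context: $(a;q)_n=\prod_{j=0}^{n-1}(1-aq^j)$, $(a_1,\dots,a_k;q)_n=\prod_i(a_i;q)_n$, and $${}_r\phi_s(a_1,\dots,a_r;b_1,\dots,b_s;q,z)=\sum_{k\ge0}\frac{(a_1,\dots,a_r;q)_k}{(q,b_1,\dots,b_s;q)_k}\left((-1)^kq^{\binom k2}\right)^{1+s-r}z^k ,$$ where the series terminates at $k=n$ if a numerator parameter equals the base to the power $-n$, $n\in\mathbb N_0$; a ''$-$'' denotes an empty list of parameters. The first series in the claim has base $q^2$, the others base $q$. Half-integer powers of $q$ are powers of the fixed $q^{1/2}$. *)

(* Defs.v *)
From mathcomp Require Import all_boot all_order all_algebra.
From mathcomp Require Import all_classical all_reals.
From mathcomp Require Import topology normedtype sequences.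
From mathcomp Require Export complex.

Set Implicit Arguments.
Unset Strict Implicit.
Unset Printing Implicit Defensive.

Import Order.TTheory GRing.Theory Num.Theory.
Import numFieldNormedType.Exports.

Local Open Scope ring_scope.

Definition qpoch (K : numFieldType) (a q : K) (n : nat) : K :=
  \prod_(j < n) (1 - a * q ^+ j).

Definition qpochs (K : numFieldType) (s : seq K) (q : K) (n : nat) : K :=
  \prod_(a <- s) qpoch a q n.

(* The exponent 1 + s - r is an integer and may be negative, whence the [int]
   power [^].  Division by zero is 0 in MathComp, so once a numerator parameter
   q^-n annihilates the terms of index k > n, they stay zero even if some
   denominator parameter also makes the denominator vanish there: the series
   then stops at k = n. *)
Definition qhyp_term (K : numFieldType) (a b : seq K) (q z : K) (k : nat) : K :=
  qpochs a q k / qpochs (q :: b) q k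
  * ((-1) ^+ k * q ^+ 'C(k, 2)) ^ (1 + (size b)%:Z - (size a)%:Z)
  * z ^+ k.

Definition qhyp (K : numFieldType) (a b : seq K) (q z : K) : K :=
  limn (series (qhyp_term a b q z)).

(* Main.v *)
Require Import Defs.
From mathcomp Require Import all_boot all_order all_algebra.
From mathcomp Require Import all_classical all_reals.
From mathcomp Require Import topology normedtype sequences.
From mathcomp Require Import ring zify.

Import GRing.Theory Num.Theory.
Import numFieldNormedType.Exports.
Local Open Scope ring_scope.

(** Write [p = q ^+ 2] and [x = z + z^-1].  All three expressions are the
    continuous q-Hermite polynomial of degree [n] in base [p], as a function of
    [x] (twice the usual variable).

    The 2phi0 is its exponential form: with its prefactor, the [k]-th term is the
    p-binomial coefficient of [n] and [k] times [z ^ (n - 2 k)].  The 3phi2 is its expansion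
    in the Askey-Wilson type basis [(r z, r / z; q)_k], which is polynomial in
    [x] because its consecutive ratios are [1 - r x q^k + q^(2 k + 1)].  The two
    agree since both satisfy the three-term recurrence
    [H_(n+2) = x H_(n+1) - (1 - p^(n+1)) H_n] with [H_0 = 1] and [H_1 = x]
    ([qhermite_exp_recurrence], [qhermite_basis_recurrence]).  Each recurrence
    is proved by creative telescoping: the combination
    [t_(n+2,k) - x t_(n+1,k) + (1 - p^(n+1)) t_(n,k)] of summands is a difference
    [G_(k+1) - G_k] in which [G_k] is a rational multiple of [t_(n+2,k)] that
    vanishes at both ends of the summation range ([recurrence2_telescope]).

    The 2phi2 is the 3phi2 summed backwards.  Reversing each shifted factorial,
    as in [(a; q)_k = (-a)^k q^binom(k,2) (q^(1-k) / a; q)_k], turns its [k]-th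
    term into the [(n - k)]-th term of the 3phi2
    ([qhermite_basis_reversed_term]); the nonvanishing hypothesis is what allows
    the cancellation of the denominators against the prefactor.

    The 3phi2 and the 2phi2 are symmetric under [z -> 1 / z] because the
    replacement permutes their parameters; the symmetry of the 2phi0 follows from
    its equality with the 3phi2. *)

(** * Shifted factorials *)

Lemma qpoch_recr {K : numFieldType} (a q : K) n :
  qpoch a q n.+1 = qpoch a q n * (1 - a * q ^+ n).
Proof. by rewrite /qpoch big_ord_recr. Qed.

Lemma qpoch0 {K : numFieldType} (a q : K) : qpoch a q 0 = 1.
Proof. by rewrite /qpoch big_ord0. Qed.

Lemma qpoch0l {K : numFieldType} (q : K) n : qpoch 0 q n = 1.
Proof. by rewrite /qpoch big1 // => j _; rewrite mul0r subr0. Qed.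

Lemma qpochD {K : numFieldType} (a q : K) m k :
  qpoch a q (m + k) = qpoch a q m * qpoch (a * q ^+ m) q k.
Proof.
rewrite /qpoch big_split_ord; congr (_ * _); apply: eq_bigr => j _ /=.
by rewrite exprD mulrA.
Qed.

Lemma qpoch_recl {K : numFieldType} (a q : K) n :
  qpoch a q n.+1 = (1 - a) * qpoch (a * q) q n.
Proof. by rewrite -add1n qpochD expr1 qpoch_recr qpoch0 mul1r expr0 mulr1. Qed.

Lemma qpoch_shift {K : numFieldType} (a q : K) n :
  qpoch (a * q) q n * (1 - a) = qpoch a q n * (1 - a * q ^+ n).
Proof. by rewrite mulrC -qpoch_recl qpoch_recr. Qed.

(** The factors of the right-hand side are those of the left-hand side in reverse
    order: by the hypothesis [b = q^(1-k) / a], so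
    [1 - a q^j = - a q^j (1 - b q^(k-1-j))].  The hypothesis is kept free of
    division so that callers need not invert [a]. *)
Lemma qpoch_reverse {K : numFieldType} (a b q : K) k :
  q != 0 -> a * b * q ^+ k = q ->
  qpoch a q k = (- a) ^+ k * q ^+ 'C(k, 2) * qpoch b q k.
Proof.
move=> q0; elim: k b => [|k IH] b hab; first by rewrite !qpoch0 !expr0 !mulr1.
have habk : a * b * q ^+ k = 1.
  by apply: (mulIf q0); rewrite mul1r -[RHS]hab exprSr mulrA.
rewrite qpoch_recr (IH (b * q)); last by rewrite mulrA mulrAC habk mul1r.
rewrite qpoch_recl binS bin1 exprD exprSr.
suff -> : 1 - a * q ^+ k = - a * q ^+ k * (1 - b) by ring.
rewrite mulrBr mulr1 !mulNr [a * _ * b]mulrAC habk; ring.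
Qed.

Lemma qpoch_eq0_expVn {K : numFieldType} (q : K) n k :
  q != 0 -> (n < k)%N -> qpoch (q ^- n) q k = 0.
Proof.
move=> q0 ltnk; rewrite /qpoch (bigD1 (Ordinal ltnk)) //=.
by rewrite mulVf ?expf_neq0 // subrr mul0r.
Qed.

Lemma expr_neq1 {K : numFieldType} (q : K) n :
  `|q| != 1 -> (0 < n)%N -> q ^+ n != 1.
Proof.
move=> nq n0; apply: contraNneq nq => /(congr1 Num.norm).
by rewrite normrX normr1 => /eqP; rewrite pexpr_eq1.
Qed.

Lemma exprN_neq1 {K : numFieldType} (q : K) n :
  `|q| != 1 -> (0 < n)%N -> 1 + q ^+ n != 0.
Proof.
move=> nq n0; rewrite addrC addr_eq0; apply: contraNneq nq => /(congr1 Num.norm).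
by rewrite normrX normrN normr1 => /eqP; rewrite pexpr_eq1.
Qed.

Lemma qpochs_cons {K : numFieldType} (a : K) s q n :
  qpochs (a :: s) q n = qpoch a q n * qpochs s q n.
Proof. by rewrite /qpochs big_cons. Qed.

Lemma qpochs_nil {K : numFieldType} (q : K) n : qpochs [::] q n = 1.
Proof. by rewrite /qpochs big_nil. Qed.

Lemma qpoch_self_neq0 {K : numFieldType} (q : K) k :
  `|q| != 1 -> qpoch q q k != 0.
Proof.
move=> nq; apply/prodf_neq0 => j _.
by rewrite -exprS subr_eq0 eq_sym expr_neq1.
Qed.

Lemma qpochN_self_neq0 {K : numFieldType} (q : K) k :
  `|q| != 1 -> qpoch (- q) q k != 0.
Proof.
move=> nq; apply/prodf_neq0 => j _.
by rewrite mulNr opprK -exprS exprN_neq1.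
Qed.

(** * Basic hypergeometric series *)

Lemma qhyp_perm {K : numFieldType} (a a' b b' : seq K) (q z : K) :
  perm_eq a a' -> perm_eq b b' -> qhyp a b q z = qhyp a' b' q z.
Proof.
move=> aa' bb'; rewrite /qhyp; congr (limn _); congr (series _).
apply/funext => k; rewrite /qhyp_term /qpochs (perm_size aa') (perm_size bb').
by rewrite (perm_big _ aa') !big_cons (perm_big _ bb').
Qed.

(** The bound [N] is left free above [n] so that series of different degrees can
    be written as sums over one common range. *)
Lemma qhyp_finite {K : numFieldType} (a b : seq K) (q z : K) n N :
  q != 0 -> q ^- n \in a -> (n < N)%N ->
  qhyp a b q z = \sum_(k < N) qhyp_term a b q z k.
Proof.
move=> q0 qa ltnN.
have term0 k : (n < k)%N -> qhyp_term a b q z k = 0.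
  move=> ltnk; rewrite /qhyp_term /qpochs (big_rem _ qa) /=.
  by rewrite qpoch_eq0_expVn // !mul0r.
rewrite /qhyp; apply: cvg_lim; first exact: norm_hausdorff.
rewrite -(cvg_shiftn N).
apply: cvg_near_cst; apply: nearW => k.
rewrite /series /= big_mkord addnC big_split_ord /= [X in _ + X]big1 ?addr0 //.
by move=> j _; apply: term0; rewrite ltn_addr.
Qed.

(** * Second-order recurrences *)

Lemma recurrence2_unique {K : numFieldType} (x : K) (c f g : nat -> K) :
  f 0 = g 0 -> f 1 = g 1 ->
  (forall n, f n.+2 = x * f n.+1 - c n * f n) ->
  (forall n, g n.+2 = x * g n.+1 - c n * g n) ->
  f =1 g.
Proof.
move=> f0 f1 Hf Hg n; suff [] : f n = g n /\ f n.+1 = g n.+1 by [].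
by elim: n => [//|n [IH1 IH2]]; split => //; rewrite Hf Hg IH1 IH2.
Qed.

(** Zeilberger's method: [G] is the certificate that makes the recurrence, applied
    to the summands, telescope.  The range is the natural one for the largest
    index [n.+2]; the summands of the smaller indices sum to the same
    value over it. *)
Lemma recurrence2_telescope {K : numFieldType} (x y : K)
    (f : nat -> K) (t : nat -> nat -> K) (G : nat -> K) n :
  (forall m N, (m < N)%N -> f m = \sum_(k < N) t m k) ->
  (forall k, t n.+2 k - x * t n.+1 k + y * t n k = G k.+1 - G k) ->
  G 0 = 0 -> G n.+3 = 0 ->
  f n.+2 = x * f n.+1 - y * f n.
Proof.
move=> fE tG G0 Gn.
rewrite !(fE _ n.+3) //; last by rewrite ltnS ltnW.
apply/eqP; rewrite -subr_eq0; apply/eqP.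
transitivity (\sum_(k < n.+3) (G k.+1 - G k)).
  rewrite -[RHS](eq_bigr _ (fun (k : 'I_n.+3) _ => tG k)) !big_split /=.
  rewrite sumrN -!mulr_sumr.
  by ring.
rewrite -(big_mkord xpredT (fun k => G k.+1 - G k)) telescope_sumr //.
by rewrite G0 Gn subr0.
Qed.

(** * Two expansions of the continuous q-Hermite polynomials *)

(** The continuous q-Hermite polynomial in base [p] at [w + w^-1], in exponential
    form: the sum of [binom(n, k)_p * w ^ (n - 2 k)]. *)
Definition qhermite_exp {K : numFieldType} (p w : K) n :=
  w ^+ n * qhyp [:: p ^- n; 0] [::] p (p ^+ n / w ^+ 2).

(** The same polynomial in base [q ^+ 2], expanded in the basis
    [(r w, r / w; q)_k], where [r ^+ 2 = q]. *)
Definition qhermite_basis {K : numFieldType} (q r w : K) n :=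
  r ^- n * qpoch (- q) q n
  * qhyp [:: q ^- n; r * w; r * w^-1] [:: - q; 0] q q.

Definition qhermite_exp_term {K : numFieldType} (p w : K) n k :=
  w ^+ n * qhyp_term [:: p ^- n; 0] [::] p (p ^+ n / w ^+ 2) k.

Definition qhermite_basis_term {K : numFieldType} (q r w : K) n k :=
  r ^- n * qpoch (- q) q n
  * qhyp_term [:: q ^- n; r * w; r * w^-1] [:: - q; 0] q q k.

Lemma qhermite_exp_termE {K : numFieldType} (p w : K) n k :
  qhermite_exp_term p w n k = w ^+ n * (qpoch (p ^- n) p k / qpoch p p k
     * ((-1) ^+ k * p ^+ 'C(k, 2))^-1 * ((p ^+ n) ^+ k / (w ^+ 2) ^+ k)).
Proof.
rewrite /qhermite_exp_term /qhyp_term !qpochs_cons !qpochs_nil qpoch0l !mulr1.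
by rewrite /= exprN1 exprMn exprVn.
Qed.

Lemma qhermite_basis_termE {K : numFieldType} (q r w : K) n k :
  qhermite_basis_term q r w n k = r ^- n * qpoch (- q) q n
  * (qpoch (q ^- n) q k * (qpoch (r * w) q k * qpoch (r * w^-1) q k)
     / (qpoch q q k * qpoch (- q) q k) * q ^+ k).
Proof.
rewrite /qhermite_basis_term /qhyp_term !qpochs_cons !qpochs_nil qpoch0l !mulr1.
by [].
Qed.

(** Lowering [n] multiplies the terminating factor by a ratio whose denominator
    does not depend on [k].  Going the other way would divide by
    [q ^+ n.+1 - q ^+ k], which vanishes at [k = n.+1]; this is why the
    certificates below are multiples of the terms of the highest degree. *)
Lemma qpoch_expVnS {K : numFieldType} (q : K) n k :
  q != 0 -> q ^+ n.+1 != 1 ->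
  qpoch (q ^- n) q k
  = qpoch (q ^- n.+1) q k * ((q ^+ n.+1 - q ^+ k) / (q ^+ n.+1 - 1)).
Proof.
move=> q0 q1; have Q0 : q ^+ n != 0 by rewrite expf_neq0.
have q1' : q ^+ n.+1 - 1 != 0 by rewrite subr_eq0.
have -> : q ^- n = q ^- n.+1 * q.
  by rewrite exprS invfM mulrC mulrA divff ?mul1r.
have := qpoch_shift (q ^- n.+1) q k.
have h : 1 - q ^- n.+1 != 0 by rewrite subr_eq0 eq_sym invr_eq1.
move/(canRL (mulfK h)) => ->.
rewrite -mulrA; congr (_ * _).
rewrite exprS in q1' h *.
by field; rewrite q1' Q0 q0.
Qed.

Lemma qhermite_exp_termSn {K : numFieldType} (p w : K) n k :
  p != 0 -> w != 0 -> p ^+ n.+1 != 1 ->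
  qhermite_exp_term p w n k = qhermite_exp_term p w n.+1 k
    * ((p ^+ n.+1 - p ^+ k) / (p ^+ n.+1 - 1) / (w * p ^+ k)).
Proof.
move=> p0 w0 p1; rewrite !qhermite_exp_termE (qpoch_expVnS p n) //.
have -> : (p ^+ n.+1) ^+ k = p ^+ k * (p ^+ n) ^+ k by rewrite exprS exprMn.
rewrite (exprS w n).
have X0 : p ^+ k != 0 by rewrite expf_neq0.
have q1' : p ^+ n.+1 - 1 != 0 by rewrite subr_eq0.
move: (qpoch (p ^- n.+1) p k) (qpoch p p k)^-1 => A A'.
move: (p ^+ n.+1) (p ^+ k) q1' X0 => P X q1' X0.
move: (((-1) ^+ k * _)^-1) (((w ^+ 2) ^+ k)^-1) (w ^+ n) ((p ^+ n) ^+ k) => B C D E.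
by field; rewrite q1' X0 w0.
Qed.

Lemma qhermite_exp_termSk {K : numFieldType} (p w : K) n k :
  p != 0 -> w != 0 -> p ^+ k.+1 != 1 ->
  qhermite_exp_term p w n k.+1 = qhermite_exp_term p w n k
    * ((p ^+ k - p ^+ n) / (1 - p ^+ k.+1) / (p ^+ k * w ^+ 2)).
Proof.
move=> p0 w0 p1; rewrite !qhermite_exp_termE !qpoch_recr binS bin1.
rewrite exprD !(exprSr (_ ^+ _)) (exprSr (-1)) -exprS !invfM invrN invr1.
have X0 : p ^+ k != 0 by rewrite expf_neq0.
have P0 : p ^+ n != 0 by rewrite expf_neq0.
have p1' : 1 - p ^+ k.+1 != 0 by rewrite subr_eq0 eq_sym.
move: (p ^+ k.+1) (p ^+ n) (p ^+ k) p1' X0 P0 => Y P X p1' X0 P0.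
move: (qpoch _ _ _) (qpoch _ _ _)^-1 ((-1) ^- k) (_ ^- 'C(k, 2)) => A B C D.
move: (P ^+ k) ((w ^+ 2) ^- k) (w ^+ n) => E F G.
by field; rewrite w0 p1' P0 X0.
Qed.

Lemma qhermite_basis_termSn {K : numFieldType} (q r w : K) n k :
  q != 0 -> r != 0 -> `|q| != 1 ->
  qhermite_basis_term q r w n k = qhermite_basis_term q r w n.+1 k
    * (r * (q ^+ n.+1 - q ^+ k) / ((q ^+ n.+1 - 1) * (1 + q ^+ n.+1))).
Proof.
move=> q0 r0 nq; rewrite !qhermite_basis_termE (qpoch_expVnS q n) ?expr_neq1 //.
rewrite (qpoch_recr _ _ n) mulNr opprK -exprS (exprS r n) [(r * _)^-1]invfM.
have q1 : q ^+ n.+1 - 1 != 0 by rewrite subr_eq0 expr_neq1.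
have q2 : 1 + q ^+ n.+1 != 0 by rewrite exprN_neq1.
move: (qpoch (q ^- n.+1) q k) (qpoch (r * w) q k * _) (qpoch q q k * _)^-1 => A B C.
move: (q ^+ n.+1) (q ^+ k) q1 q2 => P X q1 q2.
move: (r ^- n) => D.
by field; rewrite q1 q2 r0.
Qed.

Lemma qhermite_basis_termSk {K : numFieldType} (q r w : K) n k :
  q != 0 -> w != 0 -> r ^+ 2 = q -> `|q| != 1 ->
  qhermite_basis_term q r w n k.+1 = qhermite_basis_term q r w n k
    * (q * (q ^+ n - q ^+ k) * (1 - r * (w + w^-1) * q ^+ k + q * (q ^+ k) ^+ 2)
       / (q ^+ n * (1 - (q ^+ k.+1) ^+ 2))).
Proof.
move=> q0 w0 rq nq; rewrite !qhermite_basis_termE !qpoch_recr mulNr opprK -exprS.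
rewrite (exprSr q k).
have P0 : q ^+ n != 0 by rewrite expf_neq0.
have q1 : 1 - q ^+ k * q != 0 by rewrite -exprSr subr_eq0 eq_sym expr_neq1.
have q2 : 1 + q ^+ k * q != 0 by rewrite -exprSr exprN_neq1.
have q3 : 1 - (q ^+ k * q) ^+ 2 != 0.
  by rewrite -{1}(expr1n _ 2) subr_sqr mulf_neq0.
have := qpoch_self_neq0 _ k nq; have := qpochN_self_neq0 _ k nq.
move: (qpoch (- q) q k) (qpoch q q k) => B A B0 A0.
move: (qpoch (q ^- n) q k) (qpoch (r * w) q k) (qpoch (r / w) q k) => C D E.
move: (r ^- n * _) => F.
move: (q ^+ n) (q ^+ k) P0 q1 q2 q3 => P X P0 q1 q2 q3.
rewrite -!rq in q0 q1 q2 q3 *.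
have r0 : r != 0 by apply: contraNneq q0 => ->; rewrite expr0n.
by field; rewrite q3 q1 q2 A0 B0 w0 P0.
Qed.

Lemma qhermite_exp_sum {K : numFieldType} (p w : K) n N :
  p != 0 -> (n < N)%N -> qhermite_exp p w n = \sum_(k < N) qhermite_exp_term p w n k.
Proof.
move=> p0 nN; rewrite /qhermite_exp (@qhyp_finite _ _ _ _ _ n N) ?inE ?eqxx //.
by rewrite mulr_sumr.
Qed.

Lemma qhermite_basis_sum {K : numFieldType} (q r w : K) n N :
  q != 0 -> (n < N)%N ->
  qhermite_basis q r w n = \sum_(k < N) qhermite_basis_term q r w n k.
Proof.
move=> q0 nN; rewrite /qhermite_basis (@qhyp_finite _ _ _ _ _ n N) ?inE ?eqxx //.
by rewrite mulr_sumr.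
Qed.

(** The certificate comes from the p-Pascal rules: up to sign, [G_k] is
    [p^(n+2-k)] times the term [binom(n+1, k-1)_p * w^(n+2-2k)], rewritten as a
    multiple of the [k]-th term of degree [n+2]. *)
Lemma qhermite_exp_recurrence {K : numFieldType} (p w : K) n :
  p != 0 -> w != 0 -> `|p| != 1 ->
  qhermite_exp p w n.+2
  = (w + w^-1) * qhermite_exp p w n.+1 - (1 - p ^+ n.+1) * qhermite_exp p w n.
Proof.
move=> p0 w0 np; pose P := p ^+ n.+2.
apply: (@recurrence2_telescope _ _ _ (qhermite_exp p w) (qhermite_exp_term p w)
  (fun k => qhermite_exp_term p w n.+2 k * (P * (1 - p ^+ k) / (p ^+ k * (P - 1))))).
- by move=> m N; apply: qhermite_exp_sum.
- move=> k; rewrite qhermite_exp_termSk ?expr_neq1 //.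
  rewrite (qhermite_exp_termSn p w n) ?expr_neq1 //.
  rewrite (qhermite_exp_termSn p w n.+1) ?expr_neq1 //.
  move: (qhermite_exp_term _ _ _ _) => T.
  have h k' : 1 - p ^+ k'.+1 != 0 by rewrite subr_eq0 eq_sym expr_neq1.
  have h' k' : p ^+ k'.+1 - 1 != 0 by rewrite subr_eq0 expr_neq1.
  rewrite /P; move: (h k) (h' n) (h' n.+1).
  have X0 : p ^+ k != 0 by rewrite expf_neq0.
  rewrite !exprSr; move: (p ^+ n) (p ^+ k) X0 => Q X X0 h1 h2 h3.
  by field; rewrite ?w0 ?X0 ?h1 ?h2 ?h3 ?p0.
- by rewrite expr0 subrr mulr0 mul0r mulr0.
- by rewrite qhermite_exp_termE qpoch_eq0_expVn // !(mul0r, mulr0).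
Qed.

(** Multiplying [(r w, r / w; q)_k] by [w + w^-1] gives a combination of itself
    and of the next basis element, the latter with coefficient
    [- 1 / (r q^k)].  The part of [- (w + w^-1) t_(n+1,k-1)] that lands on the
    basis element of index [k] is the certificate [G_k]. *)
Lemma qhermite_basis_recurrence {K : numFieldType} (q r w : K) n :
  q != 0 -> w != 0 -> r ^+ 2 = q -> `|q| != 1 ->
  qhermite_basis q r w n.+2
  = (w + w^-1) * qhermite_basis q r w n.+1
    - (1 - (q ^+ 2) ^+ n.+1) * qhermite_basis q r w n.
Proof.
move=> q0 w0 rq nq; pose P := q ^+ n.+2.
have r0 : r != 0 by apply: contraNneq q0 => r0; rewrite -rq r0 expr0n.
apply: (@recurrence2_telescope _ _ _ (qhermite_basis q r w) (qhermite_basis_term q r w)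
  (fun k => qhermite_basis_term q r w n.+2 k
            * (P * (1 - (q ^+ k) ^+ 2) / (q ^+ k * (P - 1) * (1 + P))))).
- by move=> m N; apply: qhermite_basis_sum.
- move=> k; rewrite qhermite_basis_termSk //.
  rewrite (qhermite_basis_termSn q r w n) // (qhermite_basis_termSn q r w n.+1) //.
  move: (qhermite_basis_term _ _ _ _ _) => T.
  have h' k' : q ^+ k'.+1 - 1 != 0 by rewrite subr_eq0 expr_neq1.
  have h'' k' : 1 + q ^+ k'.+1 != 0 by rewrite exprN_neq1.
  have h : 1 - (q ^+ k.+1) ^+ 2 != 0.
    by rewrite -exprM muln2 doubleS subr_eq0 eq_sym expr_neq1.
  rewrite /P; move: h (h' n) (h' n.+1) (h'' n) (h'' n.+1).
  have X0 : q ^+ k != 0 by rewrite expf_neq0.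
  have Q0 : q ^+ n != 0 by rewrite expf_neq0.
  have -> : (q ^+ 2) ^+ n.+1 = (q ^+ n.+1) ^+ 2 by rewrite -!exprM mulnC.
  rewrite !exprSr !expr0 !mul1r; move: (q ^+ n) (q ^+ k) X0 Q0 => Q X X0 Q0 h1 h2 h3 h4 h5.
  rewrite -!rq in q0 h1 h2 h3 h4 h5 *.
  by field; rewrite ?w0 ?X0 ?Q0 ?h1 ?h2 ?h3 ?h4 ?h5 ?r0.
- by rewrite expr0 expr1n subrr mulr0 mul0r mulr0.
- by rewrite qhermite_basis_termE qpoch_eq0_expVn // !(mul0r, mulr0).
Qed.

(** Both families solve the same second-order recurrence, so comparing degrees 0
    and 1 suffices. *)
Lemma qhermite_exp_eq_basis {K : numFieldType} (q r w : K) n :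
  q != 0 -> w != 0 -> r ^+ 2 = q -> `|q| != 1 ->
  qhermite_exp (q ^+ 2) w n = qhermite_basis q r w n.
Proof.
move=> q0 w0 rq nq.
have p0 : q ^+ 2 != 0 by rewrite expf_neq0.
have np : `|q ^+ 2| != 1 by rewrite normrX pexpr_eq1.
have r0 : r != 0 by apply: contraNneq q0 => r0; rewrite -rq r0 expr0n.
move: n; apply: (@recurrence2_unique _ (w + w^-1) (fun n => 1 - (q ^+ 2) ^+ n.+1)).
- rewrite (qhermite_exp_sum _ _ _ 1) // (qhermite_basis_sum _ _ _ _ 1) //.
  rewrite !big_ord_recr !big_ord0.
  by rewrite qhermite_exp_termE qhermite_basis_termE !qpoch0 /= !(expr0, invr1, mulr1).
- rewrite (qhermite_exp_sum _ _ _ 2) // (qhermite_basis_sum _ _ _ _ 2) //.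
  rewrite !big_ord_recr !big_ord0 /=.
  have h1 := expr_neq1 _ 1 nq isT; have h2 := exprN_neq1 _ 1 nq isT.
  have h3 := expr_neq1 _ 1 np isT.
  rewrite qhermite_exp_termSk // qhermite_basis_termSk //.
  rewrite qhermite_exp_termE qhermite_basis_termE.
  rewrite !qpoch_recr !qpoch0 !(expr0, invr1, mulr1, expr1).
  rewrite expr1 in h1; rewrite expr1 in h2; rewrite expr1 in h3.
  have h4 : 1 - q ^+ 2 != 0 by rewrite subr_eq0 eq_sym.
  have h5 : q - 1 != 0 by rewrite subr_eq0.
  rewrite -!rq in q0 h1 h2 h3 h4 h5 *.
  by field; rewrite ?r0 ?w0 ?h4 ?h5.
- by move=> n; apply: qhermite_exp_recurrence.
- by move=> n; apply: qhermite_basis_recurrence.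
Qed.

(** * Reversing the order of summation *)

Lemma double_bin2 k : (2 * 'C(k, 2) + k = k ^ 2)%N.
Proof. by elim: k => // k IH; rewrite binS bin1 !expnS expn0 in IH *; lia. Qed.

(** The powers of [q] produced by reversing the shifted factorials, in terms of
    [r] because the prefactors [r ^- n] and [r ^- (n ^ 2)] are half-integer
    powers of [q]. *)
Lemma reversal_exponent {K : numFieldType} (q r : K) m k :
  r ^+ 2 = q ->
  r ^+ (m + k) * (q ^+ (m + k)) ^+ m * q ^+ 'C(k, 2)
  = r ^+ ((m + k) ^ 2) * q ^+ 'C(m, 2) * q ^+ m.
Proof.
move=> <-; rewrite -!exprM -!exprD; congr (_ ^+ _).
have := double_bin2 m; have := double_bin2 k; rewrite !expnS !expn0.
nia.
Qed.

(** Reversing [(r q^-n w; q)_k] gives [(r q^m / w; q)_k], the tail of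
    [(r / w; q)_n] in the prefactor, and likewise with [w] inverted; after
    cancellation the prefactor retains [(r w, r / w; q)_m], the basis element of
    index [m = n - k]. *)
Lemma qhermite_basis_reversed_term {K : numFieldType} (q r w : K) m k :
  q != 0 -> w != 0 -> r ^+ 2 = q -> `|q| != 1 ->
  let n := (m + k)%N in
  qpochs [:: r * w; r * w^-1] q n != 0 ->
  (-1) ^+ n * r ^- (n ^ 2) * qpochs [:: r * w; r * w^-1] q n
    * qhyp_term [:: q ^- n; - q ^- n] [:: r * q ^- n * w; r * q ^- n * w^-1]
        q (- q) k
  = qhermite_basis_term q r w n m.
Proof.
move=> q0 w0 rq nq n.
have r0 : r != 0 by apply: contraNneq q0 => r0; rewrite -rq r0 expr0n.
have N0 : q ^+ n != 0 by rewrite expf_neq0.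
have qn : q ^- n * q ^+ m * q ^+ k = 1 by rewrite -mulrA -exprD mulVf.
rewrite qhermite_basis_termE /qhyp_term !qpochs_cons !qpochs_nil !mulr1 expr1z.
rewrite (qpoch_reverse (q ^- n) (q ^+ m * q) q k) //; last first.
  by rewrite mulrA mulrAC qn mul1r.
rewrite (qpoch_reverse (- q ^- n) (- (q ^+ m * q)) q k) //; last first.
  by rewrite mulrNN mulrA mulrAC qn mul1r.
rewrite (qpoch_reverse (r * q ^- n * w) (r * w^-1 * q ^+ m) q k) //; last first.
  transitivity (r ^+ 2 * (q ^- n * q ^+ m * q ^+ k)); last by rewrite qn rq mulr1.
  by field; rewrite w0 N0.
rewrite (qpoch_reverse (r * q ^- n * w^-1) (r * w * q ^+ m) q k) //; last first.
  transitivity (r ^+ 2 * (q ^- n * q ^+ m * q ^+ k)); last by rewrite qn rq mulr1.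
  by field; rewrite w0 N0.
rewrite (qpoch_reverse (q ^- n) (q ^+ k * q) q m) //; last first.
  by rewrite mulrA mulrAC -(mulrA _ _ (q ^+ m)) (mulrC (q ^+ k)) mulrA qn mul1r.
(* Both ways of splitting [(q; q)_n] relate the reversed terminating factors
   [(q^(m+1); q)_k] and [(q^(k+1); q)_m]. *)
have := reversal_exponent q r m k rq; rewrite -/n.
have := qpochD q q k m; rewrite addnC (qpochD q q m k).
rewrite /n !(qpochD _ q m k) -/n.
rewrite !(mulrC q (q ^+ _)) mulNr (mulrC q (q ^+ m)).
have qm0 := qpoch_self_neq0 _ m nq; have qk0 := qpoch_self_neq0 _ k nq.
have qNm0 := qpochN_self_neq0 _ m nq.
move: (qpoch q q m) (qpoch q q k) (qpoch (- q) q m) qm0 qk0 qNm0 => S T U S0 T0 U0.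
move: (qpoch (r * w) q m) (qpoch (r / w) q m) => Am Bm.
move: (qpoch (r * w * _) q k) (qpoch (r / w * _) q k) => Ak Bk.
move: (qpoch _ q k) (qpoch _ q k) (qpoch _ q m) => Nk Pk Pm.
move=> /(canRL (mulKf S0)) -> hexp; rewrite !mulf_eq0 !negb_or.
case/andP=> /andP[Am0 Ak0] /andP[Bm0 Bk0].
(* The exponent identity eliminates [r ^- (n ^ 2)]; the remaining powers can be
   treated as independent quantities. *)
have -> : r ^- (n ^ 2) = r ^- n * q ^+ 'C(m, 2) * q ^+ m
                      / ((q ^+ n) ^+ m * q ^+ 'C(k, 2)).
  have nz (a : K) i : a != 0 -> a ^+ i != 0 by move=> ?; rewrite expf_neq0.
  move: hexp (nz _ n r0) (nz _ m N0) (nz _ 'C(k, 2) q0) (nz _ 'C(m, 2) q0) (nz _ m q0).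
  rewrite -mulrA; move: (r ^+ n) ((q ^+ n) ^+ m) (q ^+ 'C(k, 2)) (q ^+ 'C(m, 2)) (q ^+ m).
  move: (r ^+ (n ^ 2)) => a b c d e f h b0 c0 d0 e0 f0.
  have -> : a = b * (c * d) / e / f by rewrite h; field; rewrite e0 f0.
  by field; rewrite b0 c0 d0 e0 f0.
rewrite opprK !(exprNn (_^-1)) !(exprNn (_ * _)).
rewrite (exprNn q) !(exprMn _ (_ * _)) !(exprMn _ r) !exprVn exprD.
have -> : q ^+ k = r ^+ k * r ^+ k by rewrite -rq -exprM mulnC exprM expr2.
have : r ^+ k != 0 by rewrite expf_neq0.
have : w ^+ k != 0 by rewrite expf_neq0.
have : (q ^+ n) ^+ k != 0 by rewrite !expf_neq0.
have : (q ^+ n) ^+ m != 0 by rewrite !expf_neq0.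
have : q ^+ 'C(k, 2) != 0 by rewrite !expf_neq0.
have : ((-1) ^+ k : K) != 0 by rewrite signr_eq0.
have : ((-1) ^+ k : K) ^+ 2 = 1 by rewrite sqrr_sign.
move: ((-1) ^+ k) ((-1) ^+ m) (q ^+ 'C(k, 2)) ((q ^+ n) ^+ k) ((q ^+ n) ^+ m).
move: (r ^+ k) (w ^+ k) (q ^+ 'C(m, 2)) (r ^- n) (q ^+ m).
move=> rk wk Qm rn qm sk sm Qk Nkk Nmm sk2 sk0 Qk0 Nmm0 Nkk0 wk0 rk0.
(* The left-hand side carries two more factors [(-1)^k] than the right-hand side. *)
rewrite -[RHS]mul1r -sk2.
by field; rewrite S0 T0 U0 Ak0 Bk0 sk0 Qk0 Nmm0 Nkk0 wk0 rk0.
Qed.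

Lemma qhermite_basis_reversal {K : numFieldType} (q r w : K) n :
  q != 0 -> w != 0 -> r ^+ 2 = q -> `|q| != 1 ->
  qpochs [:: r * w; r * w^-1] q n != 0 ->
  qhermite_basis q r w n =
  (-1) ^+ n * r ^- (n ^ 2) * qpochs [:: r * w; r * w^-1] q n
    * qhyp [:: q ^- n; - q ^- n] [:: r * q ^- n * w; r * q ^- n * w^-1] q (- q).
Proof.
move=> q0 w0 rq nq adm.
rewrite (qhermite_basis_sum _ _ _ _ n.+1) // (@qhyp_finite _ _ _ _ _ n n.+1) ?inE ?eqxx //.
rewrite mulr_sumr (reindex_inj rev_ord_inj); apply: eq_bigr => -[k /= kn] _.
have := qhermite_basis_reversed_term q r w (n - k) k q0 w0 rq nq.
by rewrite /= subnK // subSS => ->.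
Qed.

(** * The three representations *)

(** Stated over an arbitrary [numFieldType]: every series terminates, so the
    identities are purely algebraic. *)
Lemma qhermite_representations {K : numFieldType} (n : nat) (q r z : K)
    (q_neq0 : q != 0) (norm_q : `|q| != 1) (z_neq0 : z != 0)
    (rq : r ^+ 2 = q) :
  let E1 (w : K) :=
    w ^+ n * qhyp [:: (q ^+ 2) ^- n; 0] [::] (q ^+ 2) (q ^+ (2 * n) / w ^+ 2) in
  let E2 (w : K) :=
    r ^- n * qpoch (- q) q n
    * qhyp [:: q ^- n; r * w; r * w^-1] [:: - q; 0] q q in
  let E3 (w : K) :=
    (-1) ^+ n * r ^- (n ^ 2) * qpochs [:: r * w; r * w^-1] q n
    * qhyp [:: q ^- n; - q ^- n] [:: r * q ^- n * w; r * q ^- n * w^-1] q (- q) in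
  let admissible := qpochs [:: r * z; r * z^-1] q n != 0 in
  [/\ E1 z = E2 z,
      admissible -> E1 z = E3 z /\ E2 z = E3 z,
      E1 z^-1 = E1 z,
      E2 z^-1 = E2 z
    & admissible -> E3 z^-1 = E3 z].
Proof.
move=> E1 E2 E3 adm.
have E12 w : w != 0 -> E1 w = E2 w.
  move=> w0; rewrite -[RHS]/(qhermite_basis q r w n).
  by rewrite -qhermite_exp_eq_basis // /E1 /qhermite_exp exprM.
have E23 : adm -> E2 z = E3 z.
  by move=> hz; rewrite -[LHS]/(qhermite_basis q r z n) qhermite_basis_reversal.
have swap2 (x y : K) : perm_eq [:: x; y] [:: y; x].
  by rewrite (perm_catC [:: x] [:: y]).
have E2V : E2 z^-1 = E2 z.
  rewrite /E2 invrK; congr (_ * _).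
  by apply: qhyp_perm; rewrite ?perm_cons ?perm_refl.
have E3V : E3 z^-1 = E3 z.
  rewrite /E3 invrK; congr (_ * _ * _); last exact: qhyp_perm.
  exact: perm_big.
by split; rewrite ?E12 ?invr_eq0 // => /E23.
Qed.

(* [r] is the fixed square root of [q]. *)
Theorem theorem6p45 (R : realType) (n : nat) (q r z : R[i])
    (q_neq0 : q != 0) (norm_q : `|q| != 1) (z_neq0 : z != 0)
    (rq : r ^+ 2 = q) :
  let E1 (w : R[i]) :=
    w ^+ n * qhyp [:: (q ^+ 2) ^- n; 0] [::] (q ^+ 2) (q ^+ (2 * n) / w ^+ 2) in
  let E2 (w : R[i]) :=
    r ^- n * qpoch (- q) q n
    * qhyp [:: q ^- n; r * w; r * w^-1] [:: - q; 0] q q in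
  let E3 (w : R[i]) :=
    (-1) ^+ n * r ^- (n ^ 2) * qpochs [:: r * w; r * w^-1] q n
    * qhyp [:: q ^- n; - q ^- n] [:: r * q ^- n * w; r * q ^- n * w^-1] q (- q) in
  let admissible := qpochs [:: r * z; r * z^-1] q n != 0 in
  [/\ E1 z = E2 z,
      admissible -> E1 z = E3 z /\ E2 z = E3 z,
      E1 z^-1 = E1 z,
      E2 z^-1 = E2 z
    & admissible -> E3 z^-1 = E3 z].
Proof.
exact: qhermite_representations.
Qed.
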